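(* Let $n\ge2$, let $\Omega\subseteq\mathbb{R}^n$ be a bounded convex domain, and let $u$ be the concave solution to the problem $$\Delta u-\sum_{i,j=1}^n\frac{u_{i}u_{j}}{1+|\nabla u|^{2}}u_{ij}+\frac{n}{u}=0\ \text{ in }\Omega,\qquad u=0\ \text{ on }\partial\Omega,\qquad u>0\ \text{ in }\Omega .$$ Suppose that $x_0\in\partial\Omega$ is an $(a,\eta)$-type point with $a\in[1,2)$ and $\eta>0$, with coordinates chosen (by translation and rotation) so that $$x_0=0,\qquad \Omega\subseteq\{(x',x_n)\in\mathbb{R}^n : x_n\ge\eta|x'|^a\}.$$ Then for every $\delta>0$ there exists a positive constant $C=C(a,\eta,d_\Omega,n,\delta)$ such that $$|u(x)|\le C|x|^{\frac{1}{a+\delta}}\qquad\text{for all }x\in\Omega\cap\{(x',x_n)\in\mathbb{R}^n : x'=0\}.$$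
   Context: Subscripts on $u$ denote partial derivatives, and a solution is understood to lie in $C(\overline\Omega)\cap C^\infty(\Omega)$. $d_\Omega$ denotes the diameter of $\Omega$. Write $x=(x',x_n)\in\mathbb{R}^n$ with $x'=(x_1,\dots,x_{n-1})$ and $|x'|=\sqrt{x_1^2+\dots+x_{n-1}^2}$. For a bounded convex domain $\Omega$, $a\in[1,+\infty)$ and $\eta>0$, a point $x_0\in\partial\Omega$ is an $(a,\eta)$-type point if, after a translation and a rotation of coordinates, $x_0=0$ and $\Omega\subseteq\{(x',x_n)\in\mathbb{R}^n : x_n\ge\eta|x'|^a\}$. The constant $C$ depends only on the listed quantities. *)

(* Defs.v *)
From mathcomp Require Import all_boot all_order all_algebra.
From mathcomp Require Import all_classical all_reals all_analysis.

Set Implicit Arguments.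
Unset Strict Implicit.
Unset Printing Implicit Defensive.

Import Order.TTheory GRing.Theory Num.Theory.
Import numFieldNormedType.Exports.

Local Open Scope classical_set_scope.
Local Open Scope ring_scope.

(* The library norm `|x| on 'rV[R]_n is the sup norm.  It induces the usual
   topology and bounded sets, but lengths and the diameter are Euclidean. *)
Definition enorm (R : realType) (n : nat) (x : 'rV[R]_n) : R :=
  Num.sqrt (\sum_(i < n) x 0 i ^+ 2).

Definition diameter (R : realType) (n : nat) (Omega : set 'rV[R]_n) : R :=
  sup [set enorm (x - y) | x in Omega & y in Omega].

Definition boundary (R : realType) (n : nat) (Omega : set 'rV[R]_n) :
    set 'rV[R]_n :=
  closure Omega `\` interior Omega.

(* Convexity makes connectedness automatic. *)
Definition bounded_convex_domain (R : realType) (n : nat)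
    (Omega : set 'rV[R]_n) : Prop :=
  [/\ open Omega, Omega !=set0, bounded_set Omega & convex_set Omega].

Definition basis_vec (R : realType) (n : nat) (i : 'I_n) : 'rV[R]_n :=
  delta_mx 0 i.

Definition partial (R : realType) (n : nat) (i : 'I_n) (f : 'rV[R]_n -> R) :
    'rV[R]_n -> R :=
  fun x => 'D_(basis_vec R i) f x.

(* For Omega open: the values of [partial i f] on Omega only depend on f in
   Omega, and the junk values outside are never used. *)
Fixpoint Ck_on (R : realType) (n : nat) (k : nat) (Omega : set 'rV[R]_n)
    (f : 'rV[R]_n -> R) : Prop :=
  (forall x, Omega x -> {for x, continuous f}) /\
  if k is k'.+1 then
    forall i : 'I_n,
      (forall x, Omega x -> derivable f x (basis_vec R i)) /\
      Ck_on k' Omega (partial i f)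
  else True.

Definition smooth_on (R : realType) (n : nat) (Omega : set 'rV[R]_n)
    (f : 'rV[R]_n -> R) : Prop :=
  forall k : nat, Ck_on k Omega f.

Definition laplacian (R : realType) (n : nat) (u : 'rV[R]_n -> R)
    (x : 'rV[R]_n) : R :=
  \sum_(i < n) partial i (partial i u) x.

Definition grad (R : realType) (n : nat) (u : 'rV[R]_n -> R) (x : 'rV[R]_n) :
    'rV[R]_n :=
  \row_(i < n) partial i u x.

Definition pde_at (R : realType) (n : nat) (u : 'rV[R]_n -> R)
    (x : 'rV[R]_n) : Prop :=
  laplacian u x
  - \sum_(i < n) \sum_(j < n)
      partial i u x * partial j u x / (1 + enorm (grad u x) ^+ 2)
      * partial j (partial i u) x
  + n%:R / u x = 0.

Definition concave_on (R : realType) (n : nat) (Omega : set 'rV[R]_n)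
    (u : 'rV[R]_n -> R) : Prop :=
  convex_function Omega (fun x => - u x).

Record concave_solution (R : realType) (n : nat) (Omega : set 'rV[R]_n)
    (u : 'rV[R]_n -> R) : Prop := ConcaveSolution {
  sol_continuous : {within closure Omega, continuous u};
  sol_smooth : smooth_on Omega u;
  sol_concave : concave_on Omega u;
  sol_pde : forall x, Omega x -> pde_at u x;
  sol_boundary : forall x, boundary Omega x -> u x = 0;
  sol_pos : forall x, Omega x -> 0 < u x
}.

(* A point of R^(m+1) is x = (x', x_last) with x' in R^m. *)
Definition xprime (R : realType) (m : nat) (x : 'rV[R]_m.+1) : 'rV[R]_m :=
  \row_(i < m) x 0 (widen_ord (leqnSn m) i).

Definition xlast (R : realType) (m : nat) (x : 'rV[R]_m.+1) : R :=
  x 0 ord_max.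

Definition power_region (R : realType) (m : nat) (a eta : R) :
    set 'rV[R]_m.+1 :=
  [set x | eta * enorm (xprime x) `^ a <= xlast x].

Definition is_rotation (R : realType) (n : nat) (Q : 'M[R]_n) : Prop :=
  Q *m Q^T = 1%:M /\ \det Q = 1.

Definition type_point (R : realType) (m : nat) (a eta : R)
    (Omega : set 'rV[R]_m.+1) (x0 : 'rV[R]_m.+1) : Prop :=
  [/\ 1 <= a, 0 < eta, boundary Omega x0 &
    exists2 Q : 'M[R]_m.+1, is_rotation Q &
      [set (x - x0) *m Q | x in Omega] `<=` power_region a eta].

(* Main.v *)
Require Import Defs.
From mathcomp Require Import all_boot all_order all_algebra.
From mathcomp Require Import all_classical all_reals all_analysis.
From mathcomp Require Import ring lra.

Set Implicit Arguments.
Unset Strict Implicit.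
Unset Printing Implicit Defensive.

Import Order.TTheory GRing.Theory Num.Theory.
Import numFieldNormedType.Exports.

Local Open Scope classical_set_scope.
Local Open Scope ring_scope.

(* On Omega put t = x_n and gam = 2 / (a + delta) < 2, and compare u^2 with the
   barrier w = A (t + eps)^gam - 5 |x'|^2.  Because Omega lies in
   {x_n >= eta |x'|^a} and gam <= 2/a, |x'|^2 is at most K (t + eps)^gam.  Take
   the least A for which u^2 <= w on the closure of Omega.  If A is large, the
   contact point is not on the boundary, where u = 0; at an interior one
   2u grad u = grad w and the Hessian of u^2 - w is nonpositive, and tracing the
   latter against the coefficients of the equation is contradictory: the concave
   term contributes -10 (n - 1), which beats 2n and the contributions of the
   t-derivatives, the latter being controlled by gam <= 2 and by A.  Hence A is
   bounded by a constant, and eps = x_n gives the estimate on the axis. *)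

(** * Directional derivatives along lines and linearity in the direction *)

Lemma is_derive_line (R : realType) (V : normedModType R) (f : V -> R)
    (x v : V) (s d : R) :
  is_derive (s *: v + x) v f d -> is_derive s 1 (fun t : R => f (t *: v + x)) d.
Proof.
have E : (fun h : R => h^-1 *:
            (((fun t : R => f (t *: v + x)) \o shift s) (h *: 1)
            - f (s *: v + x))) =
         (fun h : R => h^-1 *: ((f \o shift (s *: v + x)) (h *: v)
            - f (s *: v + x))).
  apply/funext => h /=; do 3 f_equal.
  by rewrite [h *: 1]mulr1 scalerDl addrA.
move=> [dv dE]; apply: DeriveDef; first by rewrite /derivable E.
by rewrite -dE /derive E.
Qed.

(** Stated for [t] of either sign because the increment [h * c] to which it is applied below can be
    negative. *)
Lemma mean_value_line (R : realType) (V : normedModType R) (f : V -> R)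
    (x v : V) (t : R) :
  (forall s : R, `|s| <= `|t| -> derivable f (s *: v + x) v) ->
  exists2 s : R, `|s| <= `|t| &
    f (t *: v + x) - f x = t * 'D_v f (s *: v + x).
Proof.
move=> df; pose phi (s : R) := f (s *: v + x).
have phiD (s : R) : `|s| <= `|t| -> is_derive s 1 phi ('D_v f (s *: v + x)).
  by move=> st; apply: is_derive_line; apply/derivableP/df.
have phi0 : phi 0 = f x by rewrite /phi scale0r add0r.
have cont (a b : R) : (forall s, s \in `[a, b] -> `|s| <= `|t|) ->
    {within `[a, b], continuous phi}.
  move=> ab; apply: derivable_within_continuous => s /ab st.
  by have [] := phiD _ st.
have [t0|t0] := leP 0 t.
  have sub (s : R) : s \in `[0, t] -> `|s| <= `|t|.
    by rewrite in_itv /= => /andP[s0 st]; rewrite !ger0_norm.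
  have [s /sub st E] := MVT_segment t0
    (fun s st => phiD s (sub s (subset_itv_oo_cc st))) (cont _ _ sub).
  by exists s => //; move: E; rewrite phi0 subr0 mulrC.
have sub (s : R) : s \in `[t, 0] -> `|s| <= `|t|.
  by rewrite in_itv /= => /andP[st s0]; rewrite !ler0_norm ?lerN2// ltW.
have [s /sub st E] := MVT_segment (ltW t0)
  (fun s st => phiD s (sub s (subset_itv_oo_cc st))) (cont _ _ sub).
exists s => //; move: E; rewrite phi0 sub0r => /(congr1 -%R).
by rewrite opprB mulrN opprK mulrC.
Qed.

(** The increment along [h *: (v + c *: w)] splits into one along [h *: v], whose quotient tends to
    [d], and one along [(h * c) *: w]. The mean value theorem turns the quotient of the latter,
    [q h], into [c] times ['D_w f] at a nearby point, and continuity of ['D_w f] gives its limit. *)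
Lemma is_derive_add_direction (R : realType) (V : normedModType R)
    (f : V -> R) (x v w : V) (d c : R) :
  is_derive x v f d ->
  (\forall y \near x, derivable f y w) -> {for x, continuous ('D_w f)} ->
  is_derive x (v + c *: w) f (d + c * 'D_w f x).
Proof.
move=> [dv dE] dw cw.
suff H : (fun h : R => h^-1 *: ((f \o shift x) (h *: (v + c *: w)) - f x))
    @ 0^' --> d + c * 'D_w f x.
  apply: DeriveDef; last exact: cvg_lim H.
  by apply/cvg_ex; exists (d + c * 'D_w f x).
pose q (h : R) := h^-1 *: (f (h *: (v + c *: w) + x) - f (h *: v + x)).
have -> : (fun h : R => h^-1 *: ((f \o shift x) (h *: (v + c *: w)) - f x)) =
    (fun h : R => h^-1 *: ((f \o shift x) (h *: v) - f x)) \+ q.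
  apply/funext => h /=.
  by rewrite /q -scalerDr [X in _ = _ *: X]addrC addrA subrK.
apply: cvgD; first by rewrite -dE.
apply/cvgrPdist_lt => e e0.
have [k /= k0 Hk] : exists2 k : R, 0 < k & forall y, `|y - x| < k ->
    derivable f y w /\ `|c| * `|'D_w f x - 'D_w f y| < e.
  have c1 : 0 < `|c| + 1 by rewrite ltr_wpDl.
  have /cvgrPdist_lt /(_ (e / (`|c| + 1))) := cw.
  rewrite divr_gt0// => /(_ isT) Hc.
  have /nbhs_normP[k /= k0 Hk] : nbhs x [set y | derivable f y w /\
      `|'D_w f x - 'D_w f y| < e / (`|c| + 1)] by exact: filterI dw Hc.
  exists k => // y yx; have [|dy] := Hk y; first by rewrite /= -normrN opprB.
  rewrite ltr_pdivlMr// mulrC => He; split=> //; apply: le_lt_trans He.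
  by rewrite ler_wpM2r// lerDl.
(* For [|s| <= |h * c|] the displacement [s *: w + h *: v] has norm at most [|h| * M], so
   [|h| < k / M] keeps the intermediate point in the ball of radius [k]. *)
pose M := `|v| + `|c| * `|w| + 1.
have M0 : 0 < M by rewrite ltr_wpDl// addr_ge0// mulr_ge0.
near=> h.
have h0 : h != 0 by near: h; exact: nbhs_dnbhs_neq.
have hk : `|h| < k / M.
  near: h; apply: dnbhs0_lt; exact: divr_gt0.
have close (s : R) : `|s| <= `|h * c| -> `|s *: w + (h *: v + x) - x| < k.
  move=> sh; rewrite addrA addrK; apply: le_lt_trans (ler_normD _ _) _.
  rewrite !normrZ; apply: (@le_lt_trans _ _ (`|h| * M)).
    rewrite /M; move: sh; rewrite normrM => sh.
    have := ler_wpM2r (normr_ge0 w) sh; have := normr_ge0 h; lra.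
  by rewrite -ltr_pdivlMr.
have [s sh E] : exists2 s : R, `|s| <= `|h * c| &
    f ((h * c) *: w + (h *: v + x)) - f (h *: v + x) =
    (h * c) * 'D_w f (s *: w + (h *: v + x)).
  by apply: mean_value_line => s /close /Hk[].
rewrite /q.
have -> : h *: (v + c *: w) + x = (h * c) *: w + (h *: v + x).
  by rewrite scalerDr scalerA addrA [h *: v + _]addrC.
rewrite E [_ *: _]mulrA mulrA mulVf// mul1r -mulrBr normrM.
by have [] := Hk _ (close _ sh).
Unshelve. all: by end_near. Qed.

(** [Ck_on] provides partial derivatives only. Derivatives in an arbitrary direction are obtained by
    adding the coordinate components of [v] one at a time. *)
Lemma is_derive_C1 (R : realType) (n : nat) (Omega : set 'rV[R]_n)
    (f : 'rV[R]_n -> R) (x v : 'rV[R]_n) :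
  open Omega -> Ck_on 1 Omega f -> Omega x ->
  is_derive x v f (\sum_i v 0 i * partial i f x).
Proof.
move=> Oo [_ Cf] Ox.
rewrite [X in is_derive _ X](row_sum_delta v).
elim: (index_enum _) => [|i r IH]; first by rewrite !big_nil; exact: is_derive0.
rewrite !big_cons addrC [X in is_derive _ _ _ X]addrC.
have [df [cf _]] := Cf i.
apply: is_derive_add_direction => //; last exact: cf.
have : nbhs x Omega by exact: open_nbhs_nbhs.
by apply: filterS => y /df.
Qed.

(** * Second-order conditions at a maximum *)

(** If [c] were positive, [df] would be positive just to the right of its zero at 0, and the mean
    value theorem would give [f t > f 0] for a small [t > 0]. *)
Lemma second_derivative_test (R : realType) (f df : R -> R) (c : R) :
  (\forall t \near (0:R), is_derive (t : R) 1 f (df t)) ->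
  (\forall t \near (0:R), f (t : R) <= f 0) -> is_derive (0:R) 1 df c ->
  df 0 = 0 /\ c <= 0.
Proof.
move=> Hf Hmax Hc.
have /nbhs_normP[e /= e0 He] :
    nbhs (0:R) [set t : R | is_derive t 1 f (df t) /\ f t <= f 0].
  exact: filterI Hf Hmax.
have Be (t : R) : `|t| < e -> is_derive t 1 f (df t) /\ f t <= f 0.
  by move=> te; apply: He; rewrite /= sub0r normrN.
have df0 : df 0 = 0.
  have [|dv0 _] := Be 0; first by rewrite normr0.
  have H0 : is_derive (0 : R) 1 f 0.
    apply: (@derive1_at_max R f (- e) e 0).
    - by lra.
    - by move=> t; rewrite in_itv /= -ltr_norml => /Be[[]].
    - by rewrite in_itv /= oppr_lt0 e0.
    - by move=> t; rewrite in_itv /= -ltr_norml => /Be[].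
  by rewrite -(@derive_val _ _ _ _ _ _ _ dv0) derive_val.
split=> //; rewrite leNgt; apply/negP => c0.
have [k k0 Hk] : exists2 k : R, 0 < k & forall t : R, 0 < t < k -> 0 < df t.
  have [dv dE] := Hc.
  have : (fun h : R => h^-1 *: ((df \o shift 0) (h *: 1) - df 0)) @ 0^' --> c.
    by rewrite -dE; exact: dv.
  move=> /cvgrPdist_lt /(_ _ c0) /nbhs_normP[k /= k0 Hk].
  exists k => // t /andP[t0 tk].
  have := Hk t; rewrite /= sub0r normrN gtr0_norm// => /(_ tk).
  rewrite gt_eqF// => /(_ isT).
  rewrite df0 subr0 addr0 [_ *: 1]mulr1 => H.
  have : 0 < t^-1 * df t.
    by move: H; rewrite ltr_norml => /andP[_]; rewrite ltrBlDr ltrDl.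
  by rewrite pmulr_rgt0// invr_gt0.
pose t := Num.min e k / 2.
have t0 : 0 < t by rewrite divr_gt0// lt_min e0.
have [te tk] : t < e /\ t < k.
  have : t < Num.min e k.
    by rewrite ltr_pdivrMr// mulr_natr mulr2n ltrDl lt_min e0.
  by rewrite lt_min => /andP.
have [s sI E] : exists2 s, s \in `]0, t[ & f t - f 0 = df s * (t - 0).
  apply: (@MVT R f df 0 t t0) => [s|].
    rewrite in_itv /= => /andP[s0 st].
    by have [|] := Be s; first by rewrite gtr0_norm// (lt_trans st).
  apply: derivable_within_continuous => s; rewrite in_itv /= => /andP[s0 st].
  by have [|[]] := Be s; first by rewrite ger0_norm// (le_lt_trans st).
have [|_ ft] := Be t; first by rewrite gtr0_norm.
move: sI; rewrite in_itv /= => /andP[s0 st].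
have : 0 < df s * (t - 0).
  by rewrite subr0 mulr_gt0// Hk// s0 (lt_trans st).
by rewrite -E subr_gt0 ltNge ft.
Qed.

(* With s = sqrt (1 + |p|^2) and c = 1 / (s (s + 1)), the square of I - c p p^T
   is I - p p^T / (1 + |p|^2); the test vectors are its columns. *)
Lemma trace_mean_curvature_le0 (R : realType) (n : nat) (p : 'rV[R]_n)
    (S : 'I_n -> 'I_n -> R) :
  (forall v : 'rV[R]_n, \sum_i \sum_j v 0 i * v 0 j * S i j <= 0) ->
  \sum_i S i i -
    \sum_i \sum_j p 0 i * p 0 j / (1 + enorm p ^+ 2) * S i j <= 0.
Proof.
move=> HS.
pose P := \sum_i p 0 i ^+ 2.
have P0 : 0 <= P by apply: sumr_ge0 => i _; exact: sqr_ge0.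
have -> : enorm p ^+ 2 = P by rewrite sqr_sqrtr.
pose s := Num.sqrt (1 + P).
have s0 : 0 < s by rewrite sqrtr_gt0 ltr_wpDr.
have s2 : s ^+ 2 = 1 + P by rewrite sqr_sqrtr// addr_ge0.
pose c := (s * (s + 1))^-1.
have cE : c ^+ 2 * P - 2 * c = - (1 + P)^-1.
  rewrite -s2 (_ : P = s ^+ 2 - 1); last by rewrite s2 addrC addKr.
  rewrite /c; field; apply/andP; split; apply: lt0r_neq0 => //.
  by rewrite ltr_wpDr.
pose M k : 'rV[R]_n := \row_i ((i == k)%:R - c * p 0 k * p 0 i).
have MM i j : \sum_k M k 0 i * M k 0 j = (i == j)%:R - p 0 i * p 0 j / (1 + P).
  have E k : M k 0 i * M k 0 j = (i == k)%:R * (j == k)%:R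
      - c * p 0 i * ((j == k)%:R * p 0 k) - c * p 0 j * ((i == k)%:R * p 0 k)
      + c ^+ 2 * p 0 i * p 0 j * p 0 k ^+ 2 by rewrite !mxE; ring.
  have D (i' : 'I_n) (F : 'I_n -> R) : \sum_k (i' == k)%:R * F k = F i'.
    rewrite (bigD1 i')//= eqxx mul1r big1 ?addr0// => k /negbTE.
    by rewrite eq_sym => ->; rewrite mul0r.
  rewrite (eq_bigr _ (fun k _ => E k)) big_split/= 2!sumrB -!mulr_sumr !D.
  have -> : p 0 i * p 0 j / (1 + P) = - (p 0 i * p 0 j * (c ^+ 2 * P - 2 * c)).
    by rewrite cE mulrN opprK.
  by rewrite -/P [j == i]eq_sym; ring.
have -> : \sum_i S i i - \sum_i \sum_j p 0 i * p 0 j / (1 + P) * S i j =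
    \sum_k \sum_i \sum_j M k 0 i * M k 0 j * S i j.
  rewrite [RHS]exchange_big/= -sumrB; apply: eq_bigr => i _.
  rewrite [RHS]exchange_big/=.
  under [in RHS]eq_bigr => j _ do rewrite -mulr_suml MM mulrBl.
  rewrite sumrB; congr (_ - _).
  rewrite (bigD1 i)//= eqxx mul1r big1 ?addr0// => j /negbTE.
  by rewrite eq_sym => ->; rewrite mul0r.
by apply: sumr_le0 => k _; exact: HS.
Qed.

(** The second derivative of [u ^+ 2] along the line is twice the square of the first derivative of
    [u] plus [2 * u] times its second derivative. The square is nonnegative, so dropping it keeps
    the upper bound [c]. *)
Lemma square_touched_from_above (R : realType) (n : nat)
    (Omega : set 'rV[R]_n) (u : 'rV[R]_n -> R) (x v : 'rV[R]_n)
    (w dw : R -> R) (c : R) :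
  open Omega -> Ck_on 2 Omega u -> Omega x ->
  (\forall t \near (0 : R), is_derive (t : R) 1 w (dw t)) ->
  is_derive (0 : R) 1 dw c ->
  (\forall t \near (0 : R),
    u ((t : R) *: v + x) ^+ 2 - w t <= u x ^+ 2 - w 0) ->
  2 * u x * (\sum_i v 0 i * partial i u x) = dw 0 /\
  2 * u x * (\sum_i \sum_j v 0 i * v 0 j * partial j (partial i u) x) <= c.
Proof.
move=> Oo C2 Ox Hw Hdw Hmax.
have C1 : Ck_on 1 Omega u.
  case: C2 => cu H; split=> // i; have [d [cp _]] := H i; split=> //.
pose L y := \sum_i v 0 i * partial i u y.
pose H := \sum_i \sum_j v 0 i * v 0 j * partial j (partial i u) x.
have dL : is_derive x v L H.
  have -> : L = \sum_i (v 0 i *: partial i u).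
    by apply/funext => y; rewrite fct_sumE.
  rewrite /H.
  have -> : \sum_i \sum_j v 0 i * v 0 j * partial j (partial i u) x =
      \sum_i v 0 i *: \sum_j v 0 j * partial j (partial i u) x.
    apply: eq_bigr => i _; rewrite -[RHS]/(_ * _) mulr_sumr.
    by apply: eq_bigr => j _; rewrite mulrA.
  apply: is_derive_sum => i.
  apply: is_deriveZ.
  by apply: (is_derive_C1 v Oo _ Ox); case: C2 => _ /(_ i)[].
pose l (t : R) := t *: v + x.
have l0 : l 0 = x by rewrite /l scale0r add0r.
have lO : \forall t \near (0 : R), Omega (l t).
  have cl : l t @[t --> (0 : R)] --> l 0.
    by apply: cvgD; [apply: cvgZr_tmp; exact: cvg_id|exact: cvg_cst].
  by apply: cl; rewrite l0; exact: open_nbhs_nbhs.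
have dul t : Omega (l t) -> is_derive (t : R) 1 (u \o l) (L (l t)).
  by move=> Olt; apply: is_derive_line; exact: (is_derive_C1 v Oo C1 Olt).
pose f (t : R) := u (l t) ^+ 2 - w t.
pose df (t : R) := 2 * u (l t) * L (l t) - dw t.
have [df0 Hc] : df 0 = 0 /\ 2 * (L x ^+ 2 + u x * H) - c <= 0.
  apply: (@second_derivative_test R f df).
  - near=> t.
    have Olt : Omega (l t) by near: t.
    have dut := dul t Olt.
    have dwt : is_derive (t : R) 1 w (dw t) by near: t.
    apply: is_derive_eq; by rewrite /= /df -mulrA mulrDl mul1r.
  - by near=> t; rewrite /f l0; near: t.
  - have dLl : is_derive (0 : R) 1 (L \o l) H.
      by apply: is_derive_line; rewrite -/(l 0) l0.
    have dut := dul 0; rewrite l0 in dut; have {}dut := dut Ox.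
    have -> : df = (2 *: ((u \o l) * (L \o l))) - dw.
      by apply/funext => t; rewrite /df -[RHS]/(2 * (_ * _) - _) mulrA.
    apply: is_derive_eq; by rewrite /= l0 [u x * H + L x * L x]addrC.
split; first by move/eqP: df0; rewrite /df l0 subr_eq0 => /eqP.
apply: le_trans (_ : 2 * (L x ^+ 2 + u x * H) <= c); last by rewrite -subr_le0.
by rewrite -/H; have := sqr_ge0 (L x); lra.
Unshelve. all: by end_near. Qed.

(** * The barrier along a line, and the algebra of a contact point *)

Lemma is_derive_affine_powR (R : realType) (b tau gam t : R) :
  0 < t * b + tau ->
  is_derive t 1 (fun s => (s * b + tau) `^ gam)
    (gam * (t * b + tau) `^ (gam - 1) * b).
Proof.
move=> tau0.
have D : is_derive t 1 (fun s => s * b + tau) b.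
  have -> : (fun s => s * b + tau) = (b *: id) + cst tau.
    by apply/funext => s; rewrite mulrC.
  by apply: is_derive_eq; rewrite addr0 [_ *: _]mulr1.
exact: (@is_derive1_comp R (@powR R ^~ gam) (fun s => s * b + tau) t _ _
  (is_derive1_powR gam tau0) D).
Qed.

(** On the line [s *: v + x] the barrier has this form with [b] = v_n, [tau] = x_n + eps, and [a2],
    [a1], [a0] equal to |v'|^2, x'.v' and |x'|^2. *)
Lemma is_derive_barrier (R : realType) (A gam b tau a0 a1 a2 t : R) :
  0 < t * b + tau ->
  is_derive t 1
    (fun s => A * (s * b + tau) `^ gam - 5 * (a2 * s ^+ 2 + 2 * a1 * s + a0))
    (A * gam * (t * b + tau) `^ (gam - 1) * b - 10 * (a2 * t + a1)).
Proof.
move=> tau0.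
pose q : {poly R} := a2 *: 'X^2 + (2 * a1) *: 'X + a0%:P.
have -> : (fun s => A * (s * b + tau) `^ gam -
      5 * (a2 * s ^+ 2 + 2 * a1 * s + a0)) =
    (A *: (fun s => (s * b + tau) `^ gam)) - (5 *: horner q).
  apply/funext => s; by rewrite -[RHS]/(_ * _ - _ * _) !hornerE.
have dp := is_derive_affine_powR gam tau0.
apply: is_derive_eq.
rewrite -![_ *: _]/(_ * _) /q !(derivD, derivZ, derivXn, derivX, derivC).
rewrite !hornerE /=; ring.
Qed.

Lemma is_derive_barrier2 (R : realType) (A gam b tau a1 a2 : R) :
  0 < tau ->
  is_derive (0 : R) 1
    (fun t : R => A * gam * (t * b + tau) `^ (gam - 1) * b - 10 * (a2 * t + a1))
    (A * gam * (gam - 1) * tau `^ (gam - 2) * b ^+ 2 - 10 * a2).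
Proof.
move=> tau0.
pose q : {poly R} := a2 *: 'X + a1%:P.
have -> : (fun t => A * gam * (t * b + tau) `^ (gam - 1) * b -
      10 * (a2 * t + a1)) =
    ((A * gam * b) *: (fun s => (s * b + tau) `^ (gam - 1))) - (10 *: horner q).
  apply/funext => s; rewrite -[RHS]/(_ * _ - _ * _) !hornerE.
  by rewrite -!mulrA [b * _]mulrC.
have t0 : 0 < 0 * b + tau by rewrite mul0r add0r.
have dp := is_derive_affine_powR (gam - 1) t0.
apply: is_derive_eq.
rewrite -![_ *: _]/(_ * _) /q !(derivD, derivZ, derivXn, derivX, derivC).
rewrite !hornerE /=.
rewrite (_ : gam - 1 - 1 = gam - 2); ring.
Qed.

(* The contradiction at a contact point: [u], [pn], [Q] stand for the values of
   u, u_n and |grad' u|^2 there; [g], [g1], [g2] for t^gamma and its first two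
   derivatives; [r] for |x'|^2. *)
Lemma barrier_strict (R : realFieldType) (M A K g g1 g2 r u pn Q : R) :
  1 <= M -> 0 < A -> 0 < u -> 0 <= r <= K * g ->
  u ^+ 2 + 5 * r = A * g -> 2 * u * pn = A * g1 -> u ^+ 2 * Q = 25 * r ->
  2 * g2 * g <= g1 ^+ 2 -> 20 * K <= A -> 0 <= g ->
  1000 * K * g <= A ^+ 2 * g1 ^+ 2 ->
  (1 + Q + pn ^+ 2) * (- 2 * (M + 1)) <=
     A * g2 * (1 + Q) - 10 * (M * (1 + Q + pn ^+ 2) - Q) -> False.
Proof.
move=> M1 A0 u0 /andP[r0 rK] uE pE QE g12 KA g0 KA2 H.
have u20 : 0 < u ^+ 2 by rewrite exprn_gt0.
have pE2 : 4 * (u ^+ 2 * pn ^+ 2) = A ^+ 2 * g1 ^+ 2.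
  by rewrite -[RHS]exprMn -pE; ring.
have Q0 : 0 <= Q by rewrite -(pmulr_rge0 _ u20) QE; lra.
(* The constant 1000 enters here: [4 * u ^+ 2 * pn ^+ 2 = A ^+ 2 * g1 ^+ 2] is at least
   [1000 * K * g >= 1000 * r], and [1000 * r = 40 * u ^+ 2 * Q]. *)
have Q1 : 10 * Q <= pn ^+ 2.
  rewrite -(ler_pM2l u20) mulrCA QE; nra.
(* Only [g2 > 0] has content. Since [20 * r <= A * g], u^2 (1 + Q) = u^2 + 25 r is at most 2 A g,
   and [2 * g2 * g <= g1 ^+ 2] concludes after multiplication by u^2. *)
have Q2 : A * g2 * (1 + Q) <= 4 * pn ^+ 2.
  have [g20|g20] := leP g2 0.
    apply: (@le_trans _ _ 0); last by rewrite mulr_ge0// sqr_ge0.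
    rewrite mulr_le0_ge0//; last by lra.
    by rewrite mulr_ge0_le0// ltW.
  have Ag20 : 0 < A * g2 by rewrite mulr_gt0.
  rewrite -(ler_pM2l u20) mulrCA mulrDr mulr1 QE.
  have h1 : u ^+ 2 + 25 * r <= 2 * (A * g).
    have : 20 * r <= A * g by apply: le_trans (ler_wpM2r g0 KA); lra.
    lra.
  have := ler_wpM2l (ltW Ag20) h1.
  have := ler_wpM2l (sqr_ge0 A) g12.
  have : A * g2 * (2 * (A * g)) = A ^+ 2 * (2 * g2 * g) by ring.
  have : u ^+ 2 * (4 * pn ^+ 2) = 4 * (u ^+ 2 * pn ^+ 2) by ring.
  lra.
(* With [Q1] and [Q2], [H] yields (8 M - 2)(1 + Q + pn^2) <= 5 pn^2, whereas 8 M - 2 >= 6. *)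
have := sqr_ge0 pn; have : 0 <= (M - 1) * (1 + Q + pn ^+ 2).
  by rewrite mulr_ge0 ?subr_ge0// !addr_ge0// sqr_ge0.
move: Q1 Q2 H Q0; set E := pn ^+ 2.
lra.
Qed.

(** * No contact at an interior point *)

Lemma enorm_sqr (R : realType) (n : nat) (x : 'rV[R]_n) :
  enorm x ^+ 2 = \sum_i x 0 i ^+ 2.
Proof. by rewrite sqr_sqrtr// sumr_ge0// => i _; exact: sqr_ge0. Qed.

Lemma enorm_xprime_line (R : realType) (m : nat) (x v : 'rV[R]_m.+1) (t : R) :
  enorm (xprime (t *: v + x)) ^+ 2 =
  enorm (xprime v) ^+ 2 * t ^+ 2
  + 2 * (\sum_i xprime x 0 i * xprime v 0 i) * t + enorm (xprime x) ^+ 2.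
Proof.
rewrite !enorm_sqr mulr_suml mulr_sumr mulr_suml -!big_split /=.
by apply: eq_bigr => i _; rewrite !mxE; ring.
Qed.

Definition barrier_gap (R : realType) (m : nat) (A gam eps : R)
    (u : 'rV[R]_m.+1 -> R) (x : 'rV[R]_m.+1) : R :=
  u x ^+ 2 - (A * (xlast x + eps) `^ gam - 5 * enorm (xprime x) ^+ 2).

Lemma barrier_contact (R : realType) (m : nat) (Omega : set 'rV[R]_m.+1)
    (u : 'rV[R]_m.+1 -> R) (x v : 'rV[R]_m.+1) (A gam eps : R) :
  open Omega -> Ck_on 2 Omega u -> Omega x -> 0 < xlast x + eps ->
  (forall y, Omega y ->
    barrier_gap A gam eps u y <= barrier_gap A gam eps u x) ->
  2 * u x * (\sum_i v 0 i * partial i u x) =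
    A * gam * (xlast x + eps) `^ (gam - 1) * xlast v
    - 10 * \sum_i xprime x 0 i * xprime v 0 i /\
  2 * u x * (\sum_i \sum_j v 0 i * v 0 j * partial j (partial i u) x) <=
    A * gam * (gam - 1) * (xlast x + eps) `^ (gam - 2) * xlast v ^+ 2
    - 10 * enorm (xprime v) ^+ 2.
Proof.
move=> Oo C2 Ox tau0 Hmax.
set a1 := \sum_i xprime x 0 i * xprime v 0 i.
pose tau := xlast x + eps.
pose w t := A * (t * xlast v + tau) `^ gam -
  5 * (enorm (xprime v) ^+ 2 * t ^+ 2 + 2 * a1 * t + enorm (xprime x) ^+ 2).
pose dw t := A * gam * (t * xlast v + tau) `^ (gam - 1) * xlast v
  - 10 * (enorm (xprime v) ^+ 2 * t + a1).
have wE t : A * (xlast (t *: v + x) + eps) `^ gam -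
    5 * enorm (xprime (t *: v + x)) ^+ 2 = w t.
  by rewrite enorm_xprime_line /w /tau /xlast !mxE addrA.
have dw0 : dw 0 = A * gam * tau `^ (gam - 1) * xlast v - 10 * a1.
  by rewrite /dw mul0r mulr0 !add0r.
rewrite -dw0.
apply: (square_touched_from_above Oo C2 Ox (w := w)).
- have cl : t * xlast v + tau @[t --> (0 : R)] --> 0 * xlast v + tau.
    by apply: cvgD; [apply: cvgMr_tmp; exact: cvg_id|exact: cvg_cst].
  have : \forall t \near (0 : R), 0 < (t : R) * xlast v + tau.
    by move/cvgr_gt: cl; apply; rewrite mul0r add0r.
  by apply: filterS => t; exact: is_derive_barrier.
- exact: is_derive_barrier2.
- have cl : t *: v + x @[t --> (0 : R)] --> 0 *: v + x.
    by apply: cvgD; [apply: cvgZr_tmp; exact: cvg_id|exact: cvg_cst].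
  have : \forall t \near (0 : R), Omega ((t : R) *: v + x).
    by apply: cl; rewrite scale0r add0r; exact: open_nbhs_nbhs.
  apply: filterS => t /Hmax; rewrite /barrier_gap wE.
  by have := wE 0; rewrite scale0r add0r => ->.
Qed.

(** A zero of the gap is an interior maximum. The second-order contact conditions in all directions
    are traced against I - p p^T / (1 + |p|^2), the equation eliminates the second derivatives of
    [u], and the first-order conditions express the gradient; [barrier_strict] then applies with [M]
    = n - 1. *)
Lemma no_barrier_contact (R : realType) (m : nat) (Omega : set 'rV[R]_m.+1)
    (u : 'rV[R]_m.+1 -> R) (x : 'rV[R]_m.+1) (A K D gam eps : R) :
  (0 < m)%N -> open Omega -> Ck_on 2 Omega u -> Omega x -> pde_at u x ->
  0 < u x -> 0 < xlast x + eps <= D -> 0 < gam < 2 -> 0 < A ->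
  enorm (xprime x) ^+ 2 <= K * (xlast x + eps) `^ gam ->
  20 * K <= A -> 1000 * K <= A ^+ 2 * (gam ^+ 2 * D `^ (gam - 2)) ->
  (forall y, Omega y -> barrier_gap A gam eps u y <= 0) ->
  barrier_gap A gam eps u x <> 0.
Proof.
move=> m0 Oo C2 Ox pde ux0 /andP[tau0 tauD] /andP[gam0 gam2] A0 rK KA KA2.
move=> Hmax gap0.
set tau := xlast x + eps in tau0 tauD rK.
have gap_ge0 : 0 <= barrier_gap A gam eps u x by rewrite gap0.
have contact v := @barrier_contact R m Omega u x v A gam eps Oo C2 Ox tau0
  (fun y Oy => le_trans (Hmax y Oy) gap_ge0).
pose p := grad u x.
pose pn := p 0 ord_max; pose Q := enorm (xprime p) ^+ 2.
pose g1 := gam * tau `^ (gam - 1).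
pose g2 := gam * (gam - 1) * tau `^ (gam - 2).
(* The Hessian of the barrier at [x] is diagonal with entries [d], so [S] below is [2 * u x] times
   the Hessian of [u] minus that of the barrier. *)
pose d (i : 'I_m.+1) := if i == ord_max then A * g2 else - 10.
have widen_neq (i : 'I_m) : (widen_ord (leqnSn m) i == ord_max) = false.
  by apply/negbTE; rewrite neq_ltn /= ltn_ord.
have dE (F : 'I_m.+1 -> R) : \sum_i d i * F i =
    A * g2 * F ord_max - 10 * \sum_(i < m) F (widen_ord (leqnSn m) i).
  rewrite big_ord_recr /= {2}/d eqxx addrC; congr (_ + _).
  rewrite -mulNr mulr_sumr; apply: eq_bigr => i _.
  by rewrite /d widen_neq.
pose S i j := 2 * u x * partial j (partial i u) x - (i == j)%:R * d i.
have diag (F : 'I_m.+1 -> 'I_m.+1 -> R) :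
    \sum_i \sum_j F i j * S i j =
    2 * u x * (\sum_i \sum_j F i j * partial j (partial i u) x)
    - \sum_i d i * F i i.
  rewrite mulr_sumr -sumrB; apply: eq_bigr => i _.
  rewrite mulr_sumr; apply/eqP; rewrite -subr_eq0 opprB addrCA -sumrB.
  rewrite (bigD1 i)//= big1 => [|j /negbTE ji].
    by rewrite /S eqxx mul1r; apply/eqP; ring.
  by rewrite /S eq_sym ji mul0r; ring.
have HS (v : 'rV[R]_m.+1) : \sum_i \sum_j v 0 i * v 0 j * S i j <= 0.
  rewrite diag subr_le0; have [_ /le_trans] := contact v; apply.
  rewrite dE enorm_sqr -/tau /g2 -expr2 /xlast !mulrA.
  by under [in leLHS]eq_bigr do rewrite mxE expr2.
have EP : 1 + enorm p ^+ 2 = 1 + Q + pn ^+ 2.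
  rewrite enorm_sqr big_ord_recr /= -addrA /Q enorm_sqr; congr (1 + (_ + _)).
  by apply: eq_bigr => i _; rewrite [in RHS]mxE.
have E0 : 0 < 1 + Q + pn ^+ 2 by rewrite -EP ltr_wpDr// sqr_ge0.
have := trace_mean_curvature_le0 p HS; rewrite diag.
have -> : \sum_i S i i = 2 * u x * laplacian u x - \sum_i d i * 1.
  rewrite mulr_sumr -sumrB; apply: eq_bigr => i _.
  by rewrite /S eqxx mul1r mulr1.
(* By the equation the Laplacians cancel in the trace inequality, and [2 * u x] times n / u leaves
   the constant 2 n. *)
have -> : \sum_i \sum_j p 0 i * p 0 j / (1 + enorm p ^+ 2) *
      partial j (partial i u) x = laplacian u x + m.+1%:R / u x.
  move: pde; rewrite /pde_at -/p => /eqP; rewrite addrAC subr_eq0 => /eqP ->.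
  by apply: eq_bigr => i _; apply: eq_bigr => j _; rewrite !mxE.
rewrite !dE sumr_const card_ord EP => trS.
have sum_delta n (i : 'I_n) (F : 'I_n -> R) :
    \sum_j (delta_mx 0 i : 'rV[R]_n) 0 j * F j = F i.
  rewrite (bigD1 i)//= mxE !eqxx mul1r big1 ?addr0// => j /negbTE ji.
  by rewrite mxE ji andbF mul0r.
have pnE : 2 * u x * pn = A * g1.
  have [+ _] := contact (delta_mx 0 ord_max).
  rewrite sum_delta /pn mxE => ->.
  rewrite /xlast mxE !eqxx mulr1 big1 => [|i _].
    by rewrite mulr0 subr0 mulrA.
  by rewrite !mxE widen_neq andbF mulr0.
have pE (i : 'I_m) : u x * xprime p 0 i = - 5 * xprime x 0 i.
  have [+ _] := contact (delta_mx 0 (widen_ord (leqnSn m) i)).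
  rewrite sum_delta /xlast mxE eq_sym widen_neq andbF mulr0 sub0r.
  have -> : \sum_j xprime x 0 j *
      xprime (delta_mx 0 (widen_ord (leqnSn m) i) : 'rV[R]_m.+1) 0 j =
      xprime x 0 i.
    rewrite -[RHS](sum_delta _ i (fun j => xprime x 0 j)).
    by apply: eq_bigr => j _; rewrite mulrC !mxE.
  rewrite [xprime p 0 i]mxE [p 0 _]mxE; lra.
have QE : u x ^+ 2 * Q = 25 * enorm (xprime x) ^+ 2.
  rewrite /Q !enorm_sqr !mulr_sumr; apply: eq_bigr => i _.
  by rewrite -exprMn pE; ring.
have g1E : g1 ^+ 2 = gam ^+ 2 * tau `^ (gam - 2) * tau `^ gam.
  have tau_neq0 s : (s == 0) ==> (tau != 0) by rewrite (gt_eqF tau0) implybT.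
  rewrite /g1 exprMn -mulrA [X in _ * X = _]expr2 -!powRD ?tau_neq0//.
  by congr (_ * _ `^ _); ring.
apply: (@barrier_strict R m%:R A K (tau `^ gam) g1 g2 (enorm (xprime x) ^+ 2)
  (u x) pn Q) => //.
- by rewrite ler1n.
- by rewrite sqr_ge0.
- by move: gap0; rewrite /barrier_gap -/tau; lra.
(* The difference is a nonnegative multiple of gam (2 - gam), hence the use of [gam < 2]. *)
- rewrite g1E /g2 -subr_ge0.
  set T := tau `^ (gam - 2); set T' := tau `^ gam.
  have -> : gam ^+ 2 * T * T' - 2 * (gam * (gam - 1) * T) * T' =
    gam * (2 - gam) * (T * T') by ring.
  by rewrite !mulr_ge0 ?powR_ge0//; lra.
- exact: powR_ge0.
(* The exponent [gam - 2] is negative, so [tau <= D] bounds [tau] to this power from below by that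
   power of [D]. *)
- rewrite g1E [leRHS]mulrA ler_wpM2r ?powR_ge0//.
  apply: le_trans KA2 _; rewrite ler_wpM2l ?sqr_ge0// ler_wpM2l ?sqr_ge0//.
  rewrite -[gam - 2]opprB !powRN lef_pV2 ?posrE ?powR_gt0 ?(lt_le_trans tau0)//.
  by apply: ge0_ler_powR => //; rewrite ?nnegrE; lra.
move: trS.
have EE : A * g2 * (1 + Q) = A * g2 * (1 + Q + pn ^+ 2 - pn ^+ 2).
  by rewrite addrK.
rewrite EE; move: E0; set E := 1 + Q + pn ^+ 2 => E0.
have -> : \sum_(i < m) p 0 (widen_ord (leqnSn m) i) *
    p 0 (widen_ord (leqnSn m) i) / E = Q / E.
  rewrite /Q enorm_sqr mulr_suml; apply: eq_bigr => i _.
  by rewrite [xprime p 0 i]mxE expr2.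
have -> : 2 * u x * (laplacian u x + m.+1%:R / u x) =
    2 * u x * laplacian u x + 2 * m.+1%:R.
  by field; rewrite gt_eqF.
rewrite -natr1 -expr2 -/pn -(pmulr_rle0 _ E0) => H.
rewrite -subr_le0; apply: le_trans H.
rewrite le_eqVlt; apply/orP; left; apply/eqP.
by field; rewrite gt_eqF.
Qed.

(** * Comparison with the barrier on the whole domain *)

Lemma closure_le (R : realType) (T : topologicalType) (A : set T) (f : T -> R)
    (x : T) (c : R) :
  {for x, continuous f} -> (forall y, A y -> f y <= c) -> closure A x ->
  f x <= c.
Proof.
move=> cf fA clx; rewrite leNgt; apply/negP => cx.
have [y [Ay /=]] := clx _ (cvgr_gt _ cf _ cx).
by rewrite ltNge fA.
Qed.

Lemma xlast_continuous (R : realType) (m : nat) : continuous (@xlast R m).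
Proof. exact: coord_continuous. Qed.

Lemma sqr_enorm_xprime_continuous (R : realType) (m : nat) :
  continuous (fun x : 'rV[R]_m.+1 => enorm (xprime x) ^+ 2).
Proof.
move=> x.
have -> : (fun x : 'rV[R]_m.+1 => enorm (xprime x) ^+ 2) =
    \sum_i (fun y : 'rV[R]_m.+1 => y 0 (widen_ord (leqnSn m) i)
                                   * y 0 (widen_ord (leqnSn m) i)).
  apply/funext => y; rewrite enorm_sqr fct_sumE.
  by under eq_bigr do rewrite mxE expr2.
elim/big_ind : _ => [|f h|i _]; first exact: (@cst_continuous _ _ (0 : R)).
  exact: continuousD.
by apply: continuousM; exact: coord_continuous.
Qed.

Lemma powR_xlast_continuous (R : realType) (m : nat) (eps gam : R)
    (x : 'rV[R]_m.+1) :
  0 < xlast x + eps ->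
  {for x, continuous (fun y : 'rV[R]_m.+1 => (xlast y + eps) `^ gam)}.
Proof.
move=> x0.
apply: (@continuous_comp _ _ _ (fun y : 'rV[R]_m.+1 => xlast y + eps)
  (@powR R ^~ gam)).
  by apply: continuousD; [exact: xlast_continuous|exact: cst_continuous].
apply: differentiable_continuous; apply/derivable1_diffP.
by have [] := is_derive1_powR gam x0.
Qed.

Lemma within_continuousM (R : numFieldType) (T : topologicalType) (A : set T)
    (f g : T -> R) :
  {within A, continuous f} -> {within A, continuous g} ->
  {within A, continuous (f \* g)}.
Proof. by move=> cf cg x; apply: cvgM; [exact: cf|exact: cg]. Qed.

Lemma bounded_set_closure (R : realType) (n : nat) (A : set 'rV[R]_n) :
  bounded_set A -> bounded_set (closure A).
Proof.
move=> [M [Mr HM]]; exists M; split=> // y My x.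
by apply: closure_le; [exact: norm_continuous|exact: HM].
Qed.

(** [F y] is the least coefficient for which the gap at [y] is nonpositive, so its maximum over the
    compact closure is the least admissible coefficient and the maximum point [c] is a contact point
    for it. If [F c] exceeded [A], contact would be excluded both on the boundary and inside. *)
Lemma barrier_global (R : realType) (m : nat) (Omega : set 'rV[R]_m.+1)
    (u : 'rV[R]_m.+1 -> R) (A K D gam eps : R) (x : 'rV[R]_m.+1) :
  (0 < m)%N -> bounded_convex_domain Omega -> concave_solution Omega u ->
  0 < gam < 2 -> 0 < A -> 0 <= K ->
  20 * K <= A -> 1000 * K <= A ^+ 2 * (gam ^+ 2 * D `^ (gam - 2)) ->
  (forall y, closure Omega y -> 0 < xlast y + eps <= D /\
     enorm (xprime y) ^+ 2 <= K * (xlast y + eps) `^ gam) ->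
  Omega x -> barrier_gap A gam eps u x <= 0.
Proof.
move=> m0 [Oo On0 Ob _] [cu su _ pde u0 upos] gam02 A0 K0 KA KA2 Hcl Ox.
pose g (y : 'rV[R]_m.+1) := (xlast y + eps) `^ gam.
have g0 y : closure Omega y -> 0 < g y.
  by move=> /Hcl[/andP[? _] _]; exact: powR_gt0.
pose r (y : 'rV[R]_m.+1) := 5 * enorm (xprime y) ^+ 2.
pose F y := (u y * u y + r y) / g y.
have gapE B y : closure Omega y ->
    (barrier_gap B gam eps u y <= 0) = (F y <= B).
  move=> cly; rewrite /barrier_gap expr2 subr_le0 lerBrDr -/(r y) -/(g y).
  by rewrite ler_pdivrMr ?g0.
have cF : {within closure Omega, continuous F}.
  have cr : {within closure Omega, continuous r}.
    have cr : continuous r.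
      move=> y; pose f (z : 'rV[R]_m.+1) := enorm (xprime z) ^+ 2.
      apply: (@continuousM _ _ (cst 5) f); first exact: cst_continuous.
      exact: sqr_enorm_xprime_continuous.
    exact: continuous_subspaceT.
  have cg : {within closure Omega, continuous (fun y => (g y)^-1)}.
    apply: continuous_in_subspaceT => y /set_mem cly.
    apply: continuousV; first by rewrite gt_eqF// g0.
    by apply: powR_xlast_continuous; have [/andP[]] := Hcl _ cly.
  exact: (within_continuousM
    (within_continuousD (within_continuousM cu cu) cr) cg).
have Ocl := @subset_closure _ Omega.
have [|||c /set_mem clc Fmax] := @EVT_max_rV R m.+1 F (closure Omega).
- by exists x; exact: Ocl.
- apply: bounded_closed_compact; last exact: closed_closure.
  exact: bounded_set_closure.
- exact: cF.
have {}Fmax y : closure Omega y -> F y <= F c by move=> /mem_set /Fmax.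
have [FA|AF] := leP (F c) A.
  have clx := Ocl _ Ox; rewrite gapE //; exact: le_trans (Fmax _ clx) FA.
have [tauD rK] := Hcl _ clc.
(* At a boundary point [u] vanishes, so [F c <= 5 * K <= A], against [A < F c]. *)
have Oc : Omega c.
  apply: contrapT => nOc.
  have uc : u c = 0 by apply: u0; split=> //; move/interior_id: (Oo) => ->.
  move: AF; rewrite /F uc mul0r add0r ltr_pdivlMr ?g0// ltNge => /negP; apply.
  rewrite /r; apply: (@le_trans _ _ (5 * K * g c)).
    by rewrite -mulrA ler_wpM2l.
  by rewrite ler_wpM2r ?ltW ?g0//; lra.
exfalso.
(* The coefficient is now [F c]; both size conditions on [A] persist for larger coefficients. *)
apply: (@no_barrier_contact R m Omega u c (F c) K D gam eps m0 Oo (su 2) Oc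
  (pde _ Oc) (upos _ Oc) tauD gam02 (lt_trans A0 AF) rK).
- by apply: le_trans KA _; exact: ltW.
- apply: le_trans KA2 _; apply: ler_wpM2r.
    by rewrite mulr_ge0 ?sqr_ge0 ?powR_ge0.
  apply: lerXn2r; rewrite ?nnegrE; [exact: ltW| |exact: ltW].
  exact: ltW (lt_trans A0 AF).
- by move=> y Oy; rewrite gapE; [apply: Fmax|]; exact: Ocl.
- by rewrite /barrier_gap expr2 -/(g c) /F divfK ?gt_eqF ?g0// /r addrK subrr.
Qed.

(** * Diameter and power bounds, and the estimate on the axis *)

Lemma enorm_coord_le (R : realType) (n : nat) (x : 'rV[R]_n) (i : 'I_n) :
  `|x 0 i| <= enorm x.
Proof.
rewrite -sqrtr_sqr; apply: ler_wsqrtr; rewrite (bigD1 i)//= lerDl.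
by apply: sumr_ge0 => j _; exact: sqr_ge0.
Qed.

Lemma enorm_le_norm (R : realType) (n : nat) (x : 'rV[R]_n) :
  enorm x <= Num.sqrt (n%:R * `|x| ^+ 2).
Proof.
apply: ler_wsqrtr.
have -> : n%:R * `|x| ^+ 2 = \sum_(i < n) `|x| ^+ 2.
  by rewrite sumr_const card_ord mulr_natl.
apply: ler_sum => i _; rewrite -real_normK ?num_real//.
apply: lerXn2r; rewrite ?nnegrE//.
rewrite [leRHS]/Num.Def.normr /= mx_normrE.
by apply/bigmax_geP; right; exists (ord0, i).
Qed.

Lemma enorm_le_diameter (R : realType) (n : nat) (A : set 'rV[R]_n)
    (x y : 'rV[R]_n) :
  bounded_set A -> A x -> A y -> enorm (x - y) <= diameter A.
Proof.
move=> [M [Mr HM]] Ax Ay; apply: ub_le_sup; last by exists x => //; exists y.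
(* Points of [A] have sup norm at most [M + 1], so differences have sup norm at most twice that;
   passing to the Euclidean norm costs a factor sqrt n. *)
exists (Num.sqrt (n%:R * (2 * (M + 1)) ^+ 2)) => _ [z Az [w Aw <-]].
apply: le_trans (enorm_le_norm _) _; apply: ler_wsqrtr; apply: ler_wpM2l => //.
have HM1 v : A v -> `|v| <= M + 1 by apply: HM; rewrite ltrDl.
have zw : `|z - w| <= 2 * (M + 1).
  by apply: le_trans (ler_normB _ _) _; have := HM1 _ Az; have := HM1 _ Aw; lra.
by apply: lerXn2r; rewrite ?nnegrE// (le_trans _ zw).
Qed.

(** The origin is only in the closure, so the bound on [xlast x - xlast y] for [y] in [A] is carried
    to [y = 0] by continuity. *)
Lemma xlast_le_diameter (R : realType) (m : nat) (A : set 'rV[R]_m.+1)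
    (x : 'rV[R]_m.+1) :
  bounded_set A -> closure A 0 -> A x -> xlast x <= diameter A.
Proof.
move=> Ab cl0 Ax.
have -> : xlast x = xlast x + (- xlast (0 : 'rV[R]_m.+1)).
  by rewrite /xlast mxE subr0.
apply: (@closure_le R _ A (fun y => xlast x + - xlast y)) cl0 => [|y Ay].
  apply: continuousD; first exact: cst_continuous.
  by apply: continuousN; exact: xlast_continuous.
apply: le_trans (enorm_le_diameter Ab Ax Ay).
apply: le_trans (enorm_coord_le _ ord_max).
by rewrite /xlast !mxE ler_norm.
Qed.

(** This produces the constant [K]: raise [rho]^ a <= tau / eta[to the power]2 /
    a[, then split off]tau [^ (2 / a - gam)], which is at most the same power of [D]. *)
Lemma sqr_le_powR (R : realType) (a eta gam D rho tau : R) :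
  0 < a -> 0 < eta -> gam <= 2 / a -> 0 <= rho -> 0 < tau <= D ->
  eta * rho `^ a <= tau ->
  rho ^+ 2 <= eta^-1 `^ (2 / a) * D `^ (2 / a - gam) * tau `^ gam.
Proof.
move=> a0 eta0 gama rho0 /andP[tau0 tauD] H.
have -> : rho ^+ 2 = (rho `^ a) `^ (2 / a).
  by rewrite -powRrM mulrC divfK ?gt_eqF// powR_mulrn.
have H1 : rho `^ a <= eta^-1 * tau by rewrite mulrC ler_pdivlMr// mulrC.
have s0 : 0 <= 2 / a by rewrite divr_ge0// ltW.
have ev0 : 0 <= eta^-1 by rewrite invr_ge0 ltW.
have t0 := ltW tau0.
apply: (@le_trans _ _ ((eta^-1 * tau) `^ (2 / a))).
  by apply: ge0_ler_powR; rewrite ?nnegrE ?powR_ge0 ?(mulr_ge0 ev0 t0).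
rewrite powRM// -mulrA ler_wpM2l ?powR_ge0//.
rewrite -[X in tau `^ X <= _](subrK gam) powRD; last first.
  by rewrite (gt_eqF tau0) implybT.
rewrite ler_wpM2r ?powR_ge0//; apply: ge0_ler_powR; rewrite ?subr_ge0 ?nnegrE//.
exact: le_trans tauD.
Qed.

(* The ambient dimension is n = m.+1 >= 2. *)
Theorem theorem1p3 (R : realType) (m : nat) (hn : (2 <= m.+1)%N)
    (a eta d delta : R) (ha : 1 <= a < 2) (heta : 0 < eta)
    (hdelta : 0 < delta) :
  exists2 C : R, 0 < C &
    forall (Omega : set 'rV[R]_m.+1) (u : 'rV[R]_m.+1 -> R),
      bounded_convex_domain Omega ->
      diameter Omega = d ->
      concave_solution Omega u ->
      type_point a eta Omega 0 ->
      Omega `<=` power_region a eta ->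
      forall x : 'rV[R]_m.+1, Omega x -> xprime x = 0 ->
        `|u x| <= C * enorm x `^ (1 / (a + delta)).
Proof.
have [a1 _] := andP ha.
(* With eps = x_n, the quantity y_n + eps is at most [2 * |d|] on the closure; the added 1 makes [D]
   positive for every real [d]. *)
pose gam := 2 / (a + delta); pose D := 2 * `|d| + 1.
have D0 : 0 < D by rewrite ltr_wpDl// mulr_ge0.
have ad0 : 1 < a + delta by lra.
have gam02 : 0 < gam < 2.
  rewrite divr_gt0//=; last by lra.
  by rewrite ltr_pdivrMr; lra.
have gama : gam <= 2 / a.
  by rewrite ler_wpM2l// lef_pV2 ?posrE; lra.
pose K := eta^-1 `^ (2 / a) * D `^ (2 / a - gam).
have K0 : 0 <= K by rewrite mulr_ge0 ?powR_ge0.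
pose k := gam ^+ 2 * D `^ (gam - 2).
have k0 : 0 < k by rewrite mulr_gt0 ?powR_gt0 ?exprn_gt0//; case/andP: gam02.
(* The last two terms serve the two size conditions; the 1 gives [A <= A ^+ 2], which turns
   [1000 * K / k <= A] into the quadratic one. *)
pose A := 1 + 20 * K + 1000 * K / k.
have Kk0 : 0 <= 1000 * K / k.
  by rewrite divr_ge0 ?(mulr_ge0 _ K0) ?ler0n ?(ltW k0).
have A1 : 1 <= A by rewrite /A; lra.
have A0 : 0 < A by lra.
have KA : 20 * K <= A by rewrite /A; lra.
have KA2 : 1000 * K <= A ^+ 2 * k.
  rewrite -ler_pdivrMr//; apply: (@le_trans _ _ A); first by rewrite /A; lra.
  by rewrite expr2 ler_peMl// ltW.
have B0 : 0 < A * 2 `^ gam by rewrite mulr_gt0 ?powR_gt0.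
exists (Num.sqrt (A * 2 `^ gam)); first by rewrite sqrtr_gt0.
move=> Omega u dom diam sol [_ _ [cl0 nint0] _] Opow x Ox xp0.
have [Oo _ Ob _] := dom.
have O_ge0 y : Omega y -> 0 <= xlast y.
  by move=> /Opow; apply: le_trans; rewrite mulr_ge0 ?powR_ge0 ?ltW.
have O_le y : Omega y -> xlast y <= `|d|.
  move=> Oy; apply: le_trans (ler_norm _); rewrite -diam.
  exact: xlast_le_diameter.
have enormx : enorm x = xlast x.
  rewrite /enorm big_ord_recr /= big1 => [|i _].
    by rewrite add0r sqrtr_sqr ger0_norm//; exact: O_ge0.
  by move/rowP/(_ i): xp0; rewrite !mxE => ->; rewrite expr0n.
pose t := xlast x.
(* A point of the axis with x_n = 0 would be the origin, which lies on the boundary of the open set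
   [Omega]. *)
have t0 : 0 < t.
  rewrite lt_neqAle O_ge0// andbT; apply/eqP => t0; apply: nint0.
  move/interior_id: (Oo) => ->; suff -> : 0 = x by [].
  apply/rowP => i; rewrite mxE; apply/esym/eqP.
  rewrite -normr_le0; apply: le_trans (enorm_coord_le _ _) _.
  by rewrite enormx -/t -t0.
have gap : barrier_gap A gam t u x <= 0.
  apply: (@barrier_global R m Omega u A K D gam t x) => // y cly.
  have y0 : 0 <= xlast y.
    rewrite -oppr_le0.
    apply: (@closure_le R _ Omega (fun y => - xlast y)) cly => [|z Oz].
      by apply: continuousN; exact: xlast_continuous.
    by rewrite oppr_le0 O_ge0.
  have yd : xlast y <= `|d|.
    by apply: (closure_le _ _ cly); [exact: xlast_continuous|exact: O_le].
  have xd := O_le _ Ox.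
  have yt0 : 0 < xlast y + t by rewrite ltr_wpDl.
  split; first by rewrite yt0 /= /D /t; lra.
  rewrite -subr_le0.
  (* The bound on |z'|^2 is known in [Omega] only and passes to the closure by continuity of [f] at
     [y], where the base of the power is positive. *)
  pose f (z : 'rV[R]_m.+1) := enorm (xprime z) ^+ 2 - K * (xlast z + t) `^ gam.
  apply: (@closure_le R _ Omega f _ _ _ _ cly) => [|z Oz].
    apply: continuousB; first exact: sqr_enorm_xprime_continuous.
    apply: continuousM; first exact: cst_continuous.
    exact: powR_xlast_continuous.
  rewrite subr_le0; apply: sqr_le_powR => //; first by lra.
  - exact: sqrtr_ge0.
  - by rewrite ltr_wpDl ?O_ge0//=; have := O_le _ Oz; rewrite /D /t; lra.
  - by apply: le_trans (Opow _ Oz) _; rewrite lerDl ltW.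
have ux0 : 0 < u x by exact: sol_pos sol _ Ox.
rewrite gtr0_norm// enormx -/t -(@ler_pXn2r _ 2) ?nnegrE ?(ltW ux0)//;
  last first.
  by rewrite mulr_ge0 ?sqrtr_ge0 ?powR_ge0.
rewrite exprMn sqr_sqrtr ?(ltW B0)//.
rewrite -[X in _ * X]powR_mulrn ?powR_ge0// -powRrM.
rewrite (_ : 1 / (a + delta) * 2%:R = gam); last by rewrite mul1r mulrC.
move: gap; rewrite /barrier_gap xp0 -/t subr_le0.
rewrite enorm_sqr big1 => [|i _]; last by rewrite mxE expr0n.
have -> : t + t = 2 * t by rewrite mulr_natl mulr2n.
by rewrite mulr0 subr0 powRM ?(ltW t0)// mulrA.
Qed.
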